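(* Let $t > 2$ and $1 \leq k_1 \leq \cdots \leq k_t$ be integers with $n = k_1 + \cdots + k_t \geq 4$, and let $X$ be a graph on $n$ vertices. If $X$ is a tree and does not contain an $(n-k_t)$-bridge, then $\mathsf{FS}(X, K_{k_1,\ldots,k_t})$ is connected.
   Context: All graphs are simple. For graphs $X, Y$ on $n$ vertices, the friends-and-strangers graph $\mathsf{FS}(X,Y)$ has as vertices all bijections $\sigma: V(X) \to V(Y)$; two bijections $\sigma, \sigma'$ are adjacent iff there is an edge $\{a,b\} \in E(X)$ with $\{\sigma(a),\sigma(b)\} \in E(Y)$, $\sigma'(a) = \sigma(b)$, $\sigma'(b) = \sigma(a)$, and $\sigma'(c) = \sigma(c)$ for all other $c$. $K_{k_1,\ldots,k_t}$ denotes the complete $t$-partite graph with partition classes of sizes $k_1,\ldots,k_t$. A path $v_1, \ldots, v_k$ in a graph is a $k$-bridge if each edge of the path is a cut-edge, $v_2,\ldots,v_{k-1}$ have degree $2$, and $v_1, v_k$ do not have degree $1$; a single cut-vertex is a $1$-bridge. *)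

(* Defs.v *)
From mathcomp Require Import all_boot.

Set Implicit Arguments.
Unset Strict Implicit.
Unset Printing Implicit Defensive.

Record sgraph (T : finType) := SGraph {
  adj : rel T;
  adj_sym : symmetric adj;
  adj_irr : irreflexive adj
}.

Section Graph.
Variables (T : finType) (X : sgraph T).

Definition degree (v : T) : nat := #|[set w | adj X v w]|.

Definition connected : Prop := forall u v : T, connect (adj X) u v.

(* As [adj X] is symmetric and irreflexive, the repetition-free closed walks
   [ucycle] of length at least 3 are exactly the cycles of the graph; those of
   length 2 run back and forth along an edge. *)
Definition acyclic : Prop :=
  forall c : seq T, ucycle (adj X) c -> size c < 3.

Definition is_tree : Prop := connected /\ acyclic.

Definition del_edge (a b : T) : rel T :=
  fun u v => adj X u v && ([set u; v] != [set a; b]).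

Definition cut_edge (a b : T) : bool :=
  adj X a b && (n_comp (adj X) predT < n_comp (del_edge a b) predT).

Definition del_vertex (a : T) : rel T :=
  fun u v => [&& adj X u v, u != a & v != a].

(* Components are counted over the vertices other than [a], since [a] is still
   an (isolated) point of the relation [del_vertex a]. *)
Definition cut_vertex (a : T) : bool :=
  n_comp (adj X) predT < n_comp (del_vertex a) (predC1 a).

(* For [p = v1 :: q], [behead (belast v1 q)] is [p] without its endpoints. *)
Definition is_bridge (p : seq T) : bool :=
  match p with
  | [::] => false
  | [:: v] => cut_vertex v
  | v1 :: q =>
      [&& uniq p, sorted cut_edge p,
          all (fun v => degree v == 2) (behead (belast v1 q)),
          degree v1 != 1 & degree (last v1 q) != 1]
  end.

Definition has_bridge (k : nat) : Prop :=
  exists2 p : seq T, size p = k & is_bridge p.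

End Graph.

Section FriendsAndStrangers.
Variables (T U : finType) (X : sgraph T) (Y : sgraph U).

Definition bij : finType :=
  {s : {ffun T -> U} | injectiveb s && [forall y, exists x, s x == y]}.

Definition fs_adj (s s' : bij) : bool :=
  [exists a, exists b,
    [&& adj X a b, adj Y (val s a) (val s b),
        val s' a == val s b, val s' b == val s a &
        [forall c, (c != a) && (c != b) ==> (val s' c == val s c)]]].

Lemma fs_adj_sym : symmetric fs_adj.
Proof.
suff H s s' : fs_adj s s' -> fs_adj s' s by move=> s s'; apply/idP/idP; apply: H.
case/existsP=> a /existsP[b] /and5P[Xab Yab /eqP s'a /eqP s'b /forallP s'c].
apply/existsP; exists a; apply/existsP; exists b.
rewrite s'a s'b !eqxx Xab adj_sym Yab /=.
by apply/forallP=> c; rewrite [val s c == _]eq_sym; apply: s'c.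
Qed.

Lemma fs_adj_irr : irreflexive fs_adj.
Proof.
move=> s; apply/negbTE/negP; case/existsP=> a /existsP[b] /and5P[_ Yab /eqP sab _ _].
by rewrite sab adj_irr in Yab.
Qed.

Definition FS : sgraph bij := SGraph fs_adj_sym fs_adj_irr.

End FriendsAndStrangers.

Section Multipartite.
Variables (t : nat) (k : t.-tuple nat).

Definition multipartite_vertex : finType := {i : 'I_t & 'I_(tnth k i)}.

Definition multipartite_adj : rel multipartite_vertex :=
  fun u v => tag u != tag v.

Lemma multipartite_adj_sym : symmetric multipartite_adj.
Proof. by move=> u v; rewrite /multipartite_adj eq_sym. Qed.

Lemma multipartite_adj_irr : irreflexive multipartite_adj.
Proof. by move=> u; rewrite /multipartite_adj eqxx. Qed.

Definition complete_multipartite : sgraph multipartite_vertex :=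
  SGraph multipartite_adj_sym multipartite_adj_irr.

End Multipartite.

(* Main.v *)
Require Import Defs.
From mathcomp Require Import all_boot all_fingroup.

(* Two persons p, q of the same class are exchangeable in a configuration s if
   s composed with the transposition (p q) lies in the component of s.  As (p q)
   is an automorphism of the multipartite graph, this depends only on the
   component of s, and it is transitive in p, q within a class.  If it always
   holds, then swapping two adjacent positions never leaves the component, and
   these swaps generate all permutations since X is connected.

   Exchangeability is proved by induction on the number k of persons of the
   class, for a tree on N vertices without (N-k)-bridge.  If k = 2, the tree is
   not a path, so it has a claw; bring to it the two persons and two others of
   different classes, and use that FS(K_{1,3}, K_{1,1,2}) is connected.  If
   k >= 3, deleting either end of a longest path creates no (N-k)-bridge: all
   but one of the neighbours of the end's neighbour are leaves.  Put persons of
   the class on both ends; by induction, all the others are exchangeable when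
   either end is frozen, and a third person of the class links the two ends. *)

(** Links the two ways of naming the interior of a path: [behead (belast x q)], as in [is_bridge],
    and consecutive triples, as in [ind_bridge]. *)
Lemma inner_vertex_split (T : eqType) (x v : T) (q : seq T) :
  v \in behead (belast x q) ->
  exists s1 a d s2, x :: q = s1 ++ [:: a, v, d & s2].
Proof.
case/lastP: q => [|q z] //; rewrite belast_rcons /=.
case/splitPr=> s1 s2; case/lastP: s1 => [|s1 a].
  by case: s2 => [|d s2];
    [exists [::], x, z, [::] | exists [::], x, d, (rcons s2 z)].
by case: s2 => [|d s2];
  [exists (x :: s1), a, z, [::] | exists (x :: s1), a, d, (rcons s2 z)];
  rewrite /= ?rcons_cat -?cats1 /= -?catA.
Qed.

(** * Bridges, longest paths and leaves in induced subgraphs of a tree *)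

Section InducedSubgraph.
Set Implicit Arguments.
Unset Strict Implicit.
Variables (T : finType) (X : sgraph T).
Implicit Types (S : {set T}) (p b : seq T).

(** Subgraphs keep the vertex type [T], so that configurations keep their type when leaves are
    deleted. *)
Definition ind_adj S : rel T := [rel u v | [&& adj X u v, u \in S & v \in S]].

Definition ind_degree S v : nat := #|[set w | ind_adj S v w]|.

Definition ind_connected S : Prop :=
  {in S &, forall u v, connect (ind_adj S) u v}.

(* For [size b >= 2] in a tree this is the paper's notion of bridge: an end of
   [b] has positive degree, so its degree differs from 1 iff it exceeds 1. *)
Definition ind_bridge S b : Prop :=
  [/\ uniq b, sorted (ind_adj S) b,
      {in b, forall v, 1 < ind_degree S v} &
      forall s1 a v d s2, b = s1 ++ [:: a, v, d & s2] -> ind_degree S v = 2].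

Definition longest_path S p : Prop :=
  [/\ uniq p, sorted (ind_adj S) p, {subset p <= S} &
      forall q, uniq q -> sorted (ind_adj S) q -> {subset q <= S} ->
        size q <= size p].

Lemma ind_adj_sym S : symmetric (ind_adj S).
Proof. by move=> u v; rewrite /ind_adj /= adj_sym (andbC (u \in S)). Qed.

Lemma ind_adj_sub S1 S2 u v : S1 \subset S2 -> ind_adj S1 u v -> ind_adj S2 u v.
Proof. by move/subsetP=> sS /and3P[Xuv /sS uS /sS vS]; apply/and3P. Qed.

Lemma ind_adj_neq S u v : ind_adj S u v -> u != v.
Proof. by case/and3P=> Xuv _ _; apply: contraTneq Xuv => ->; rewrite adj_irr. Qed.

Lemma ind_degree_sub S1 S2 v : S1 \subset S2 -> ind_degree S1 v <= ind_degree S2 v.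
Proof.
move=> sS; apply/subset_leq_card/subsetP=> w; rewrite !in_set.
exact: ind_adj_sub.
Qed.

(** Inner vertices have degree 2 and thus qualify as ends, so bridges can be shortened to a
    prescribed length. *)
Lemma ind_bridge_take S b m : ind_bridge S b -> ind_bridge S (take m b).
Proof.
case=> Ub pb db ib; split.
- exact: take_uniq.
- exact: take_sorted.
- by move=> v /mem_take; apply: db.
- move=> s1 a v d s2 def; apply: (ib s1 a v d (s2 ++ drop m b)).
  by rewrite -{1}(cat_take_drop m b) def -catA.
Qed.

Lemma longest_path_exists S : exists p, longest_path S p.
Proof.
pose P i := [exists t : i.-tuple T,
  [&& uniq t, sorted (ind_adj S) t & all [in S] t]].
have P0 : exists i, P i by exists 0; apply/existsP; exists [tuple].
have Pb i : P i -> i <= #|T|.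
  case/existsP=> t /and3P[Ut _ _]; rewrite -(size_tuple t) -(card_uniqP Ut).
  exact: max_card.
case: (ex_maxnP P0 Pb) => i /existsP[t /and3P[Ut pt /allP tS]] max_i.
exists t; split=> // q Uq pq qS; rewrite size_tuple; apply: max_i.
apply/existsP; exists (in_tuple q); rewrite /= Uq pq /=; exact/allP.
Qed.

Lemma longest_path_rev S p : longest_path S p -> longest_path S (rev p).
Proof.
case=> Up pp pS max_p; split.
- by rewrite rev_uniq.
- rewrite rev_sorted (@eq_sorted _ _ (ind_adj S)) // => u v; exact: ind_adj_sym.
- by move=> v; rewrite mem_rev; apply: pS.
- by move=> q; rewrite size_rev; apply: max_p.
Qed.

Lemma path_triple S s1 a v d s2 (b := s1 ++ [:: a, v, d & s2]) :
  uniq b -> sorted (ind_adj S) b -> [/\ ind_adj S v a, ind_adj S v d & a != d].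
Proof.
rewrite cat_uniq => /and3P[_ _ /andP[+ _]]; rewrite !inE !negb_or => /and3P[_ -> _].
by move/cat_sorted2=> [_ /and3P[Sav Svd _]]; rewrite ind_adj_sym.
Qed.

Hypothesis acyc : acyclic X.

(** Such an edge would close the segment from [x] to [z] into a cycle, of length at least 3 because
    of [y]. *)
Lemma acyclic_no_chord S x y z p1 p2 :
  uniq (x :: y :: p1 ++ z :: p2) ->
  path (ind_adj S) x (y :: p1 ++ z :: p2) -> adj X z x = false.
Proof.
rewrite -cat_rcons -!cat_cons cat_uniq cat_path => /and3P[Up _ _] /andP[pp _].
apply/negP=> Xzx; suff /acyc : ucycle (adj X) [:: x, y & rcons p1 z].
  by rewrite /= size_rcons.
apply/andP; split=> //; rewrite (cycle_path x) /= last_rcons Xzx /=.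
by apply: (@sub_path _ (ind_adj S)) pp => u v /and3P[].
Qed.

(** A second neighbour of [x] would either prolong the path or give a chord. *)
Lemma longest_path_head S x y p z :
  longest_path S [:: x, y & p] -> ind_adj S x z -> z = y.
Proof.
move=> lp Sxz; case: (lp) => Up pp pS max_p.
have [/and3P[Xxz xS zS] zx] := (Sxz, ind_adj_neq Sxz).
have [zp|zp] := boolP (z \in [:: x, y & p]); last first.
  suff : size [:: z, x, y & p] <= size [:: x, y & p] by rewrite /= ltnn.
  apply: max_p; first by rewrite cons_uniq zp.
    by rewrite /= ind_adj_sym Sxz.
  by move=> v; rewrite inE => /predU1P[-> //|]; apply: pS.
move: zp; rewrite !inE eq_sym (negPf zx) /= => /predU1P[//|zp].
case/splitPr: zp Up pp {pS max_p lp} => p1 p2 Up pp.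
by have := acyclic_no_chord Up pp; rewrite adj_sym Xxz.
Qed.

Lemma longest_path_nbr_leaf S x y z p w u v :
  longest_path S [:: x, y, z & p] -> ind_adj S y w -> w != z ->
  ind_adj S w u -> ind_adj S w v -> u = v.
Proof.
move=> lp Syw wz; have [-> Sxu Sxv|wx] := eqVneq w x.
  by rewrite (longest_path_head lp Sxu) (longest_path_head lp Sxv).
(* Replacing [x] by [w] gives another longest path. *)
suff lw : longest_path S [:: w, y, z & p].
  by move=> Swu Swv; rewrite (longest_path_head lw Swu) (longest_path_head lw Swv).
case: (lp) => Up /= /andP[Sxy pp] pS max_p; split=> //.
(* If [w] lay on the path beyond [z], its edge to [y] would be a chord. *)
- rewrite cons_uniq; case/andP: (Up) => _ Uyp; rewrite [uniq _]Uyp andbT.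
  apply/negP=> wp.
  have wp1 : w \in z :: p.
    by move: wp; rewrite inE eq_sym (negPf (ind_adj_neq Syw)).
  move: wp1; rewrite inE (negPf wz) /= => wp1.
  case/splitPr: wp1 Uyp pp {Up wp pS max_p lp} => p1 p2 Up pp.
  by have := acyclic_no_chord Up pp; case/and3P: Syw; rewrite adj_sym => ->.
- by rewrite /= ind_adj_sym Syw.
- move=> a; rewrite inE => /predU1P[->|ap]; first by case/and3P: Syw.
  by apply: pS; rewrite inE ap orbT.
Qed.

(** The retraction [r] of the leaf [x] onto [y] turns walks in [S] into walks in [S :\ x], the steps
    between [x] and [y] becoming stationary. *)
Lemma ind_connected_leaf S x y p :
  longest_path S [:: x, y & p] -> ind_connected S -> ind_connected (S :\ x).
Proof.
move=> lp conS u v; rewrite !inE => /andP[ux uS] /andP[vx vS].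
have Sxy : ind_adj S x y by case: lp => _ /andP[].
pose r w := if w == x then y else w.
have rP a c : ind_adj S a c -> connect (ind_adj (S :\ x)) (r a) (r c).
  rewrite /r => Sac; case: eqVneq => [ax|ax].
    rewrite ax in Sac; rewrite (longest_path_head lp Sac).
    by rewrite eq_sym (negPf (ind_adj_neq Sxy)) connect0.
  case: eqVneq => [cx|cx].
    by rewrite ind_adj_sym cx in Sac; rewrite (longest_path_head lp Sac) connect0.
  apply: connect1; case/and3P: Sac => Xac aS cS.
  by apply/and3P; rewrite !inE ax cx.
have /connectP[q] := conS u v uS vS.
suff H a : path (ind_adj S) a q -> connect (ind_adj (S :\ x)) (r a) (r (last a q)).
  by move=> /H/[swap]<-; rewrite /r (negPf ux) (negPf vx).
elim: q a => [|c q IHq] a /=; first by rewrite connect0.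
by case/andP=> /rP Sac /IHq; apply: connect_trans.
Qed.

(** Deleting [x] changes the degree of no remaining vertex but [y], so only [y] as an inner vertex
    of [b] could do harm. Its two neighbours on [b] would not be leaves, and [z] is its only
    neighbour that can fail to be a leaf. *)
Lemma ind_bridge_leaf S x y z p b :
  longest_path S [:: x, y, z & p] -> ind_bridge (S :\ x) b -> ind_bridge S b.
Proof.
move=> lp [Ub pb db ib]; have sS : S :\ x \subset S := subsetDl _ _.
split=> // [|v /db dv|s1 a v d s2 def].
- by apply: sub_sorted pb => u v; apply: ind_adj_sub.
- exact: leq_trans dv (ind_degree_sub _ sS).
have leaf w : w \in b -> ind_adj S y w -> w = z.
  move=> /db dw Syw; apply/eqP/negPn/negP=> wz.
  case/card_gt1P: dw => u [u' [] ]; rewrite !inE => Swu Swu' /negP[]; apply/eqP.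
  by apply: (longest_path_nbr_leaf lp Syw wz); apply: ind_adj_sub sS _.
have := Ub; have := pb; rewrite def => pb' /path_triple/(_ pb')[Sva Svd ad].
have [vy|vy] := eqVneq v y.
  have ab : a \in b by rewrite def mem_cat !inE eqxx orbT.
  have dbb : d \in b by rewrite def mem_cat !inE eqxx !orbT.
  rewrite vy in Sva Svd; case/eqP: ad; apply: etrans (leaf a ab _) (esym (leaf d dbb _)).
    exact: ind_adj_sub sS Sva.
  exact: ind_adj_sub sS Svd.
rewrite -(ib _ _ _ _ _ def) /ind_degree; apply: eq_card => w; rewrite !inE.
have vx : v != x by case/and3P: Sva => _ /setD1P[].
rewrite /ind_adj /= !in_setD1 vx /=; case: (eqVneq w x) => //= wx.
rewrite !andbF; apply: contraNF vy; rewrite wx => /and3P[Xvx vS xS].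
by apply/eqP/(longest_path_head lp); rewrite ind_adj_sym; apply/and3P.
Qed.

(** Serves to show that a path exhausts [S]. *)
Lemma ind_connected_closed S x p :
  ind_connected S -> x \in S -> x \in p ->
  (forall u v, u \in p -> ind_adj S u v -> v \in p) -> #|S| <= size p.
Proof.
move=> conS xS xp clp; apply: leq_trans (card_size p).
apply/subset_leq_card/subsetP=> v vS.
have /connectP[q pq ->] := conS x v xS vS.
elim: q x xp pq {xS vS} => [|y q IHq] x xp //= /andP[Sxy]; apply: IHq.
exact: clp Sxy.
Qed.

Lemma longest_path_size2 S p :
  ind_connected S -> 1 < #|S| -> longest_path S p -> 1 < size p.
Proof.
move=> conS S2 [_ _ _ max_p]; case/card_gt1P: S2 => u [v [uS vS uv]].
have /connectP[[|w q] /= ] := conS u v uS vS; first by move=> _ vu; rewrite vu eqxx in uv.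
case/andP=> Suw _ _; apply: (max_p [:: u; w]).
- by rewrite /= inE (ind_adj_neq Suw).
- by rewrite /= Suw.
- by case/and3P: Suw => _ _ wS z; rewrite !inE => /orP[]/eqP->.
Qed.

Lemma longest_path_last S x y q v :
  longest_path S [:: x, y & q] -> ind_adj S (last y q) v -> v \in [:: x, y & q].
Proof.
move/longest_path_rev; have -> : rev [:: x, y & q] = last y q :: rev (x :: belast y q).
  by rewrite (lastI y) -rcons_cons rev_rcons.
have := mem_rev (x :: belast y q); rewrite (lastI y) -rcons_cons => mr lp.
case def: (rev (x :: belast y q)) (rev_cons x (belast y q)) => [|z r] Er.
  by case: (rev _) Er.
rewrite def in lp => /(longest_path_head lp) ->.
by rewrite mem_rcons inE -mr def mem_head orbT.
Qed.

(** The vertices of a longest path of size 2 are both leaves, so they would already make up all of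
    [S]. *)
Lemma longest_path_size3 S p :
  ind_connected S -> 2 < #|S| -> longest_path S p -> 2 < size p.
Proof.
move=> conS S3 lp; have := longest_path_size2 conS (ltnW S3) lp.
case: p lp => [|x [|y [|//]]] // lp _; apply: leq_trans S3 _.
have xS : x \in S by case: lp => _ _ /(_ x (mem_head _ _)).
apply: (ind_connected_closed conS xS (mem_head _ _)) => u v.
rewrite !inE => /orP[] /eqP-> Suv.
  by rewrite (longest_path_head lp Suv) eqxx orbT.
by have := longest_path_last lp Suv; rewrite !inE.
Qed.

(** The neighbours on a longest path use up the degree bound, so the path is closed under adjacency
    and covers [S]. Without its two ends, it is the bridge. *)
Lemma ind_bridge_max_degree2 S :
  ind_connected S -> 1 < #|S| -> (forall v, ind_degree S v <= 2) ->
  exists2 b, size b = #|S| - 2 & ind_bridge S b.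
Proof.
move=> conS S2 deg2; have [p lp] := longest_path_exists S.
have := longest_path_size2 conS S2 lp.
case: p lp => [|x [|y q]] // lp _; have [Up pp pS _] := lp.
have nbr s1 a v d s2 : [:: x, y & q] = s1 ++ [:: a, v, d & s2] ->
    [set w | ind_adj S v w] = [set a; d] /\ ind_degree S v = 2.
  move=> def; rewrite def in Up pp; have [Sva Svd ad] := path_triple Up pp.
  have E : [set w | ind_adj S v w] = [set a; d].
    apply/esym/eqP; rewrite eqEcard cards2 ad deg2 andbT.
    by apply/subsetP=> w; rewrite !inE => /orP[]/eqP->.
  by rewrite /ind_degree E cards2 ad.
have sizeS : #|S| = (size q).+2.
  have -> : (size q).+2 = #|[:: x, y & q]| by rewrite (card_uniqP Up).
  apply/eqP; rewrite eqn_leq [X in _ && X]subset_leq_card ?andbT; last exact/subsetP.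
  rewrite (card_uniqP Up).
  apply: (ind_connected_closed conS (pS x (mem_head _ _)) (mem_head _ _)) => u v.
  rewrite {1}(lastI y) -rcons_cons mem_rcons !inE => /or3P[/eqP->|/eqP->|ub Suv].
  - exact: longest_path_last lp.
  - by move/(longest_path_head lp)->; rewrite eqxx orbT.
  - have [s1 [a [d [s2 def]]]] := @inner_vertex_split T x u (y :: q) ub.
    have [/setP/(_ v) + _] := nbr _ _ _ _ _ def; rewrite !inE Suv => /esym.
    by rewrite -!in_cons def mem_cat !inE => /orP[]->; rewrite ?orbT.
have deg_b v : v \in belast y q -> ind_degree S v = 2.
  by move=> vb; case: (@inner_vertex_split T x v (y :: q) vb) => s1 [a [d [s2 /nbr[]]]].
exists (belast y q); first by rewrite size_belast sizeS subn2.
split.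
- by move: Up; rewrite cons_uniq lastI rcons_uniq => /and3P[].
- by move/path_sorted: pp; rewrite lastI -cats1 => /cat_sorted2[].
- by move=> v /deg_b->.
- by move=> s1 a v d s2 def; apply: deg_b; rewrite def mem_cat !inE eqxx !orbT.
Qed.

End InducedSubgraph.

(** * Configurations as permutations, and reachability by swaps *)

Section Configurations.
Set Implicit Arguments.
Unset Strict Implicit.
Local Open Scope group_scope.
Variables (T : finType).

Section Generation.
Variables (S : {set T}) (e : rel T) (P : {perm T} -> Prop).
Hypothesis P1 : P 1.
Hypothesis PM : forall s s', P s -> P s' -> P (s * s').
Hypothesis Pe : forall a b, e a b -> P (tperm a b).

(** Induction along a path: [tperm a c] is the conjugate of [tperm d c] by [tperm a d], where [d]
    precedes [c]. *)
Lemma tperm_connect a b : connect e a b -> P (tperm a b).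
Proof.
case/connectP=> p; elim/last_ind: p b => [|p c IHp] b /=.
  by move=> _ ->; rewrite tperm1.
rewrite rcons_path last_rcons => /andP[/IHp/(_ erefl) Pac ecb ->].
set d := last a p in Pac ecb.
have [->|ac] := eqVneq a c; first by rewrite tperm1.
have [<-|dc] := eqVneq d c; first by [].
have -> : tperm a c = tperm a d * tperm d c * tperm a d.
  have := tpermJ d c (tperm a d).
  by rewrite tpermR (tpermD ac dc) conjgE tpermV mulgA => <-.
by do !apply: PM => //; apply: Pe.
Qed.

Hypothesis connS : {in S &, forall u v, connect e u v}.

Lemma perm_on_map ps qs :
  uniq ps -> uniq qs -> size ps = size qs ->
  {subset ps <= S} -> {subset qs <= S} ->
  exists2 s, P s & perm_on S s /\ map s ps = qs.
Proof.
elim: ps qs => [|p ps IHps] [|q qs] //=.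
  by move=> *; exists 1 => //; split=> //; apply: perm_on1.
case/andP=> pps Ups /andP[qqs Uqs] [szs] pS qS.
have [s Ps [sS def]] : exists2 s, P s & perm_on S s /\ map s ps = qs.
  by apply: IHps => // x xp; [apply: pS | apply: qS]; rewrite inE xp orbT.
have yS : s^-1 q \in S by rewrite (perm_closed _ (perm_onV sS)) qS ?mem_head.
have pS' : p \in S by rewrite pS ?mem_head.
(* The left factor acts first. It fixes [ps] pointwise, since [q] is not in [qs], and corrects only
   the image of [p]. *)
exists (tperm p (s^-1 q) * s).
  by apply: PM => //; apply: tperm_connect; apply: connS.
split.
  apply: perm_onM => //; apply/subsetP=> z; rewrite !inE.
  by case: tpermP => [-> //|-> //|]; rewrite eqxx.
rewrite permM tpermL permKV; congr (_ :: _); rewrite -def.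
apply/eq_in_map=> z zp; rewrite permM tpermD //; first by apply: contraNneq pps => ->.
apply: contraNneq qqs => zq; rewrite -def; apply/mapP; exists z => //.
by rewrite -zq permKV.
Qed.

End Generation.

Variables (X : sgraph T) (C : eqType) (col : T -> C).
Implicit Types (S : {set T}) (s : {perm T}).

(* A configuration [s] sends positions to persons, so [s * tperm p q] exchanges
   the persons [p] and [q], and [tperm a b * s] swaps the positions [a] and [b]. *)
Definition swap_step S : rel {perm T} := [rel s s' : {perm T} |
  [exists a, exists b,
    [&& ind_adj X S a b, col (s a) != col (s b) & s' == tperm a b * s]]].

Definition reach S := connect (swap_step S).

Lemma swap_stepP S s a b :
  ind_adj X S a b -> col (s a) != col (s b) -> reach S s (tperm a b * s).
Proof.
move=> Sab cab; apply: connect1; apply/existsP; exists a; apply/existsP; exists b.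
by rewrite Sab cab eqxx.
Qed.

Lemma reach_sym S s s' : reach S s s' -> reach S s' s.
Proof.
suff H : symmetric (swap_step S) by rewrite /reach (sym_connect_sym H).
suff H u v : swap_step S u v -> swap_step S v u by move=> u v; apply/idP/idP; apply: H.
case/existsP=> a /existsP[b] /and3P[Sab cab /eqP ->].
apply/existsP; exists a; apply/existsP; exists b.
by rewrite Sab mulgA tperm2 mul1g eqxx !permM tpermL tpermR eq_sym cab.
Qed.

Lemma reach_sub S1 S2 s s' : S1 \subset S2 -> reach S1 s s' -> reach S2 s s'.
Proof.
move=> sS; apply: connect_sub => u v /existsP[a /existsP[b] /and3P[Sab cab /eqP->]].
by apply: swap_stepP => //; apply: ind_adj_sub sS _.
Qed.

Lemma reach_imset S s s' : reach S s s' -> s' @: S = s @: S.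
Proof.
case/connectP=> r; elim: r s => [|s1 r IHr] s /=; first by move=> _ ->.
case/andP=> /existsP[a /existsP[b] /and3P[/and3P[_ aS bS] _ /eqP def]].
move=> /IHr{}IHr /IHr ->; rewrite def.
apply/setP=> z; apply/imsetP/imsetP=> -[x xS ->].
  by exists (tperm a b x); rewrite ?permM //; case: tpermP => [_|_|].
by exists (tperm a b x); rewrite ?permM ?tpermK //; case: tpermP => [_|_|].
Qed.

(** Exchanging persons acts on the right and swapping positions on the left, so the two commute;
    equal colours keep every swap legal. *)
Lemma reach_tperm S s s' p q :
  col p = col q -> reach S s s' -> reach S (s * tperm p q) (s' * tperm p q).
Proof.
move=> cpq; have ct x : col (tperm p q x) = col x by case: tpermP => // ->.
case/connectP=> r; elim: r s => [|s1 r IHr] s /=; first by move=> _ ->; exact: connect0.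
case/andP=> /existsP[a /existsP[b] /and3P[Sab cab /eqP def]].
move=> /IHr{}IHr /IHr; apply: connect_trans; rewrite def -mulgA.
by apply: swap_stepP; rewrite ?permM ?ct.
Qed.

Definition exchangeable S s p q := reach S s (s * tperm p q).

Lemma exchangeable_reach S s s' p q :
  col p = col q -> reach S s s' -> exchangeable S s' p q -> exchangeable S s p q.
Proof.
move=> cpq ss' ex; apply: (connect_trans ss' (connect_trans ex _)).
exact: reach_sym (reach_tperm cpq ss').
Qed.

(** [tperm p r] is the conjugate of [tperm q r] by [tperm p q], and [reach_tperm] transports the
    given walks to the intermediate configurations. *)
Lemma exchangeable_trans S s p q r :
  col p = col q -> col q = col r ->
  exchangeable S s p q -> exchangeable S s q r -> exchangeable S s p r.
Proof.
move=> cpq cqr pq qr; rewrite /exchangeable.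
have [->|pr] := eqVneq p r; first by rewrite tperm1 mulg1; apply: connect0.
have [<-|rq] := eqVneq q r; first by [].
have -> : s * tperm p r = s * tperm p q * tperm q r * tperm p q.
  have := tpermJ q r (tperm p q).
  by rewrite tpermR (tpermD pr rq) conjgE tpermV !mulgA => <-; rewrite !mulgA.
exact: (connect_trans pq (reach_tperm cpq (connect_trans qr (reach_tperm cqr pq)))).
Qed.

End Configurations.

(** * Exchanging persons of the same class *)

Section Exchange.
Set Implicit Arguments.
Unset Strict Implicit.
Local Open Scope group_scope.
Variables (T : finType) (X : sgraph T) (C : eqType) (col : T -> C).
Implicit Types (S : {set T}) (s : {perm T}).
Local Notation reach := (reach X col).
Local Notation exchangeable := (exchangeable X col).

(** Only colours can be prescribed, not persons: a transposition of two adjacent positions of equal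
    colour is illegal, but leaves the colouring unchanged and can be skipped. *)
Lemma reach_recolor S s ps qs :
  ind_connected X S -> uniq ps -> uniq qs -> size ps = size qs ->
  {subset ps <= S} -> {subset qs <= S} ->
  exists2 s', reach S s s' & [seq col (s' x) | x <- ps] = [seq col (s x) | x <- qs].
Proof.
move=> conS Up Uq szpq pS qS.
pose P (r : {perm T}) := forall s,
  exists2 s', reach S s s' & forall x, col (s' x) = col (s (r x)).
have [|r1 r2 P1 P2|a b Sab|r Pr [_ <-]] :=
  @perm_on_map T S (ind_adj X S) P _ _ _ conS ps qs Up Uq szpq pS qS.
- by move=> s0; exists s0 => [|x]; rewrite ?perm1 //; apply: connect0.
- move=> s0; have [s1 r01 c1] := P2 s0; have [s2 r12 c2] := P1 s1.
  by exists s2 => [|x]; [apply: connect_trans r01 r12 | rewrite c2 c1 permM].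
- move=> s0; have [cab|cab] := eqVneq (col (s0 a)) (col (s0 b)).
    by exists s0 => [|x]; [apply: connect0 | case: tpermP => // ->].
  exists (tperm a b * s0) => [|x]; last by rewrite permM.
  exact: swap_stepP.
have [s' ss' cs'] := Pr s; exists s' => //.
by rewrite -map_comp; apply: eq_map => x /=.
Qed.

Lemma claw_exchange S s w n1 n2 n3 :
  ind_adj X S w n1 -> ind_adj X S w n2 -> ind_adj X S w n3 ->
  uniq [:: n1; n2; n3] -> col (s n1) = col (s n2) ->
  uniq [:: col (s w); col (s n1); col (s n3)] ->
  exchangeable S s (s n1) (s n2).
Proof.
move=> a1 a2 a3 Un c12.
(* Since positions off the claw are left alone, the four persons on the claw determine [s']. *)
pose St a b c d s' := [/\ s' w = a, s' n1 = b, s' n2 = c, s' n3 = d &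
  forall z, z \notin [:: w; n1; n2; n3] -> s' z = s z].
pose Q a b c d := exists2 s', reach S s s' & St a b c d s'.
have [w1 w2 w3] := And3 (ind_adj_neq a1) (ind_adj_neq a2) (ind_adj_neq a3).
have [n12 n13 n23] : [/\ n1 != n2, n1 != n3 & n2 != n3].
  by move: Un; rewrite /= !inE negb_or andbT => /andP[/andP[-> ->] ->].
have out n z : n \in [:: n1; n2; n3] -> z \notin [:: w; n1; n2; n3] -> tperm w n z = z.
  move=> nn; rewrite inE negb_or => /andP[zw zn]; rewrite tpermD //; first by rewrite eq_sym.
  by apply: contraNneq zn => <-.
have Q1 a b c d : col a != col b -> Q a b c d -> Q b a c d.
  move=> cab [s' ss' [sw s1 s2 s3 so]]; exists (tperm w n1 * s').
    by apply: connect_trans ss' _; apply: swap_stepP; rewrite ?sw ?s1.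
  split=> [||||z zn]; rewrite permM; last by rewrite out ?so // !inE eqxx ?orbT.
  1-4: by rewrite ?tpermL ?tpermR // tpermD // eq_sym.
have Q2 a b c d : col a != col c -> Q a b c d -> Q c b a d.
  move=> cab [s' ss' [sw s1 s2 s3 so]]; exists (tperm w n2 * s').
    by apply: connect_trans ss' _; apply: swap_stepP; rewrite ?sw ?s2.
  split=> [||||z zn]; rewrite permM; last by rewrite out ?so // !inE eqxx ?orbT.
  1-4: by rewrite ?tpermL ?tpermR // tpermD // eq_sym.
have Q3 a b c d : col a != col d -> Q a b c d -> Q d b c a.
  move=> cab [s' ss' [sw s1 s2 s3 so]]; exists (tperm w n3 * s').
    by apply: connect_trans ss' _; apply: swap_stepP; rewrite ?sw ?s3.
  split=> [||||z zn]; rewrite permM; last by rewrite out ?so // !inE eqxx ?orbT.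
  1-4: by rewrite ?tpermL ?tpermR // tpermD // eq_sym.
rewrite /= !inE negb_or andbT => /andP[/andP[cw1 cw3] c13].
have [cw2 c23] : col (s w) != col (s n2) /\ col (s n2) != col (s n3).
  by rewrite -c12.
(* Write (x; u, v, y) for the persons on (w; n1, n2, n3): swapping w in turn with
   n1, n3, n1, n2, n1, n3, n2 leads to (x; v, u, y). *)
have : Q (s w) (s n1) (s n2) (s n3) by exists s => //; apply: connect0.
move/(Q1 _ _ _ _ cw1)/(Q3 _ _ _ _ c13).
rewrite eq_sym in cw3; move/(Q1 _ _ _ _ cw3)/(Q2 _ _ _ _ cw2)/(Q1 _ _ _ _ c23).
rewrite eq_sym in c13; rewrite eq_sym in cw1.
move/(Q3 _ _ _ _ c13)/(Q2 _ _ _ _ cw1).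
case=> s' ss' [sw s1 s2 s3 so]; rewrite /exchangeable.
suff -> : s * tperm (s n1) (s n2) = s' by [].
apply/permP=> z; rewrite permM.
have [|zn] := boolP (z \in [:: w; n1; n2; n3]); last first.
  rewrite so // tpermD // (inj_eq perm_inj); apply: contraNneq zn => <-.
    by rewrite !inE eqxx ?orbT.
  by rewrite !inE eqxx ?orbT.
rewrite !inE => /or4P[] /eqP->; rewrite ?tpermL ?tpermR //;
  by rewrite tpermD // (inj_eq perm_inj) // eq_sym.
Qed.

Lemma exchangeable_refl S s p : exchangeable S s p p.
Proof. by rewrite /exchangeable tperm1 mulg1; apply: connect0. Qed.

Lemma exchangeable_sym S s p q : exchangeable S s p q = exchangeable S s q p.
Proof. by rewrite /exchangeable tpermC. Qed.

(** The persons [x] and [y] supply the colours for the centre and the third leaf of the claw. *)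
Lemma exchangeable_pair c S s :
  acyclic X -> ind_connected X S -> #|[set p in s @: S | col p == c]| = 2 ->
  (exists x y, [/\ x \in s @: S, y \in s @: S & uniq [:: c; col x; col y]]) ->
  (forall b, size b = #|S| - 2 -> ~ ind_bridge X S b) ->
  {in s @: S &, forall p q, col p = c -> col q = c -> exchangeable S s p q}.
Proof.
move=> acyc conS K2 [x [y [xS yS cxy]]] nobr p q pS qS cp cq.
have [->|pq] := eqVneq p q; first exact: exchangeable_refl.
have neqc u v : col u != col v -> u != v by apply: contra_neq => ->.
have [cx cy] : col x != c /\ col y != c.
  by move: cxy; rewrite /= !inE negb_or -!(eq_sym c) => /andP[/andP[]].
have xy : x != y by apply: neqc; move: cxy; rewrite /= !inE => /and3P[].
have Upq : uniq [:: x; p; q; y].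
  by rewrite /= !inE !negb_or pq xy !andbT !neqc // ?cp ?cq // eq_sym.
(* Otherwise [S] is a path, whose interior is a forbidden bridge. *)
have : exists w, 2 < ind_degree X S w.
  apply/existsP/contraT; rewrite negb_exists => /forallP le2.
  have [|v|b sb /(nobr _ sb)//] := ind_bridge_max_degree2 acyc conS.
    rewrite -(card_imset _ (@perm_inj _ s)); apply/card_gt1P.
    by exists p, q; split.
  by rewrite leqNgt.
case=> w /card_gt2P[n1 [n2 [n3 [[]]]]]; rewrite !in_set => a1 a2 a3 [n12 n23 n31].
case/imsetP: xS Upq cx cxy {xy} => x0 x0S ->; case/imsetP: yS cy => y0 y0S ->.
case/imsetP: pS cp pq => p0 p0S -> cp; case/imsetP: qS cq => q0 q0S -> cq pq.
move=> cy Upq cx cxy.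
have Un : uniq [:: w; n1; n2; n3].
  rewrite /= !inE !negb_or n12 n23 [n1 == n3]eq_sym n31.
  by rewrite (ind_adj_neq a1) (ind_adj_neq a2) (ind_adj_neq a3).
have [||||s' ss' [cw c1 c2 c3]] :=
  @reach_recolor S s [:: w; n1; n2; n3] [:: x0; p0; q0; y0] conS Un.
- by rewrite -(map_inj_uniq (@perm_inj _ s)).
- by [].
- case/and3P: a1 => _ wS n1S; case/and3P: a2 => _ _ n2S; case/and3P: a3 => _ _ n3S.
  by apply/allP; rewrite /= wS n1S n2S n3S.
- by apply/allP; rewrite /= x0S p0S q0S y0S.
have := claw_exchange (s := s') a1 a2 a3; rewrite cw c1 c2 c3 cp cq => /(_ _ erefl).
have Un' : uniq [:: n1; n2; n3] by case/andP: Un.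
have Uc : uniq [:: col (s x0); c; col (s y0)].
  move: cxy; rewrite /= !inE !negb_or !andbT => /andP[/andP[_ cy0] xy0].
  by rewrite cx xy0 cy0.
move/(_ Un' Uc) => ex; apply: (exchangeable_reach _ ss'); first by rewrite cp cq.
(* Only colours were prescribed, but the class has just two persons on [S], so [n1] and [n2] hold
   these two in some order. *)
have mem n : ind_adj X S w n -> col (s' n) = c -> s' n \in [set s p0; s q0].
  move=> /and3P[_ _ nS] cn.
  suff <- : [set p in s @: S | col p == c] = [set s p0; s q0].
    by rewrite inE cn eqxx andbT -(reach_imset ss') imset_f.
  apply/esym/eqP; rewrite eqEcard cards2 pq K2 andbT; apply/subsetP=> u.
  by rewrite !inE => /orP[]/eqP->; rewrite ?cp ?cq eqxx imset_f.
have : s' n1 != s' n2 by rewrite (inj_eq perm_inj).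
have := mem n1 a1; have := mem n2 a2; rewrite c1 c2 cp cq => /(_ erefl) + /(_ erefl).
rewrite !inE => /orP[]/eqP E2 /orP[]/eqP E1; rewrite E1 E2 ?eqxx // => _; rewrite -E1 -E2 //.
by rewrite exchangeable_sym.
Qed.

(** Freezing a leaf that holds a person of class [c] lowers [#|S|] and [k] together, so the
    forbidden bridge length [#|S| - k] is invariant under the induction. *)
Lemma same_color_exchangeable c k S s :
  acyclic X -> ind_connected X S ->
  #|[set p in s @: S | col p == c]| = k ->
  (exists x y, [/\ x \in s @: S, y \in s @: S & uniq [:: c; col x; col y]]) ->
  (forall b, size b = #|S| - k -> ~ ind_bridge X S b) ->
  {in s @: S &, forall p q, col p = c -> col q = c -> exchangeable S s p q}.
Proof.
move=> acyc; elim: k S s => [|k IHk] S s conS cK blanks nobr p q pS qS cp cq.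
  by move/cards0_eq/setP/(_ p): cK; rewrite !inE pS cp eqxx.
have [->|pq] := eqVneq p q; first exact: exchangeable_refl.
have [k1|] := leqP k 1.
  suff k2 : k.+1 = 2.
    by rewrite k2 in cK nobr; apply: (exchangeable_pair acyc conS cK blanks nobr).
  apply/eqP; rewrite eqn_leq ltnS k1 -cK; apply/card_gt1P.
  by exists p, q; rewrite !inE pS qS cp cq eqxx.
move=> k2; have S3 : 2 < #|S|.
  rewrite -(card_imset _ (@perm_inj _ s)); apply: leq_trans (_ : k.+1 <= _) => //.
  by rewrite -cK; apply/subset_leq_card/subsetP=> u; rewrite inE => /andP[].
have [l lp] := longest_path_exists X S.
have [x [x' [xx' xS x'S [y [z [r dl]]] [y' [z' [r' dl']]]]]] : exists x x',
    [/\ x != x', x \in S, x' \in S, exists y z r, l = [:: x, y, z & r] &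
         exists y z r, rev l = [:: x', y, z & r]].
  have := longest_path_size3 acyc conS S3 lp.
  have /(longest_path_size3 acyc conS S3) := longest_path_rev lp.
  case def: l lp => [|x [|y [|z r]]] // lp.
  case def': (rev _) (longest_path_rev lp) => [|x' [|y' [|z' r']]] // lp' _ _.
  exists x, x'; split; [| | | by exists y, z, r | by exists y', z', r'].
  - have [/andP[xr _] _ _ _] := lp; apply: contraNneq xr => ->.
    rewrite -mem_rev; move: def'; rewrite rev_cons.
    by case: (rev _) => //= a u [-> _]; rewrite mem_head.
  - by case: lp => _ _ + _; apply; rewrite mem_head.
  - by case: lp' => _ _ + _; apply; rewrite mem_head.
case/imsetP: pS cp pq => p0 p0S -> cp; case/imsetP: qS cq => q0 q0S -> cq pq.
(* The positions [p0] and [q0] show that colour [c] occurs twice, so both ends of the path can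
   receive it. *)
have [||||s' ss' [cx cx']] :=
  @reach_recolor S s [:: x; x'] [:: p0; q0] conS _ _ erefl.
- by rewrite /= inE xx'.
- by rewrite -(map_inj_uniq (@perm_inj _ s)) /= inE pq.
- by apply/allP; rewrite /= xS x'S.
- by apply/allP; rewrite /= p0S q0S.
rewrite cp in cx; rewrite cq in cx'.
apply: (exchangeable_reach _ ss'); first by rewrite cp cq.
have leaf w : w \in S -> (exists y z r, longest_path X S [:: w, y, z & r]) ->
    col (s' w) = c -> {in s @: S &, forall u v, col u = c -> col v = c ->
      u != s' w -> v != s' w -> exchangeable S s' u v}.
  move=> wS [y1 [z1 [r1 lw]]] cw.
  have im u : (u \in s' @: (S :\ w)) = (u != s' w) && (u \in s @: S).
    rewrite -(reach_imset ss'); apply/imsetP/andP => [[u' /setD1P[u'w u'S] ->]|].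
      by rewrite (inj_eq perm_inj) imset_f.
    case=> + /imsetP[u' u'S def]; rewrite def (inj_eq perm_inj) => u'w.
    by exists u'; rewrite // !inE u'w.
  move=> u v uS vS cu cv uw vw; apply: (@reach_sub _ _ _ _ (S :\ w)).
    exact: subsetDl.
  have wS' : s' w \in s @: S by rewrite -(reach_imset ss') imset_f.
  apply: IHk => //; rewrite ?im ?uw ?vw //.
  - exact: ind_connected_leaf acyc _ _ _ _ lw conS.
  - apply/eqP; rewrite -eqSS -cK [X in _ == X](cardsD1 (s' w)) inE wS' cw eqxx add1n eqSS.
    by apply/eqP; apply: eq_card => t; rewrite !inE im andbA.
  - case: blanks => a [b [aS bS cab]]; exists a, b; split=> //; rewrite im ?aS ?bS andbT.
      by apply: contraTneq cab => ->; rewrite /= cw !inE eqxx.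
    by apply: contraTneq cab => ->; rewrite /= cw !inE eqxx orbT.
  - move=> b sb /(ind_bridge_leaf acyc lw); apply: nobr.
    by rewrite sb [in RHS](cardsD1 w) wS add1n subSS.
have lx : exists y z r, longest_path X S [:: x, y, z & r] by exists y, z, r; rewrite -dl.
have lx' : exists y z r, longest_path X S [:: x', y, z & r].
  by exists y', z', r'; rewrite -dl'; apply: longest_path_rev.
(* The class has at least three persons on [S], so one of them, [t], sits on neither end. *)
have /card_gt0P[t] : 0 < #|[set u in s @: S | col u == c] :\ s' x :\ s' x'|.
  have : 2 < #|[set u in s @: S | col u == c]| by rewrite cK.
  rewrite (cardsD1 (s' x)) (cardsD1 (s' x') (_ :\ _)) addnA.
  by case: posnP => // ->; do 2!case: (_ \in _).
case/setD1P=> tx' /setD1P[tx]; rewrite inE => /andP[tS /eqP ct].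
have exx := leaf x xS lx cx; have exx' := leaf x' x'S lx' cx'.
have sxx' : s' x != s' x' by rewrite (inj_eq perm_inj).
have trans u v : col u = c -> col v = c ->
    exchangeable S s' u t -> exchangeable S s' t v -> exchangeable S s' u v.
  by move=> cu cv; apply: exchangeable_trans; rewrite ?cu ?cv ct.
have [pS qS] : s p0 \in s @: S /\ s q0 \in s @: S by rewrite !imset_f.
(* At most one of the two persons is on [x]. That one is exchanged with [t] while [x'] is frozen,
   the other while [x] is frozen. *)
have [px|px] := eqVneq (s p0) (s' x); last first.
  have [qx|qx] := eqVneq (s q0) (s' x); last exact: exx.
  by apply: trans => //; [apply: exx | apply: exx'; rewrite // qx].
by apply: trans => //; [apply: exx'; rewrite // px | apply: exx; rewrite // -px eq_sym].
Qed.
End Exchange.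

(** * From induced bridges to bridges of the tree *)

Section Tree.
Set Implicit Arguments.
Unset Strict Implicit.
Variables (T : finType) (X : sgraph T).

(** A path from [a] to [b] avoiding the edge would close to a cycle with it. So the deletion
    separates [a] from [b], and the number of components rises from 1. *)
Lemma tree_cut_edge a b : is_tree X -> adj X a b -> cut_edge X a b.
Proof.
case=> conX acyc Xab; rewrite /cut_edge Xab /=.
have symX : connect_sym (adj X) by apply/sym_connect_sym/adj_sym.
have symD : connect_sym (del_edge X a b).
  by apply: sym_connect_sym => u v; rewrite /del_edge adj_sym setUC.
have -> : n_comp (adj X) predT = 1.
  rewrite -(n_comp_connect symX a); apply: eq_n_comp_r => v.
  by rewrite !inE conX.
apply/card_gt1P; exists (root (del_edge X a b) a), (root (del_edge X a b) b).
split; rewrite ?inE ?roots_root // root_connect //; apply/negP=> /connectP[p].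
move/shortenP=> [q pq Uq _] lb.
have /acyc : ucycle (adj X) (a :: q).
  apply/andP; split=> //; rewrite (cycle_path a) /= -lb adj_sym Xab.
  by apply: sub_path pq => u v /andP[].
case: q pq lb {Uq} => [|c [|//]] /=; first by move=> _ ab; rewrite ab adj_irr in Xab.
by rewrite andbT => /andP[_ +] bc; rewrite bc eqxx.
Qed.

Lemma ind_degree_setT v : ind_degree X setT v = degree X v.
Proof. by apply: eq_card => w; rewrite !inE /ind_adj /= !in_setT !andbT. Qed.

Lemma ind_connected_setT : connected X -> ind_connected X setT.
Proof.
move=> conX u v _ _; rewrite (@eq_connect _ _ (adj X)) // => x y.
by rewrite /ind_adj /= !in_setT !andbT.
Qed.

(** The size bound excludes single vertices, for which [is_bridge] asks for a cut-vertex instead of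
    degree conditions. *)
Lemma ind_bridge_setT b : is_tree X -> 1 < size b ->
  ind_bridge X setT b -> is_bridge X b.
Proof.
move=> tree; case: b => [|v1 [|v2 q]] // _ [Ub pb db ib].
rewrite /is_bridge Ub /=; apply/and4P; split.
- apply: sub_path pb => u v /and3P[+ _ _]; exact: tree_cut_edge.
- apply/allP=> v vb.
  have [s1 [a [d [s2 def]]]] := @inner_vertex_split T v1 v (v2 :: q) vb.
  by rewrite -ind_degree_setT (ib _ _ _ _ _ def).
- by have := db v1 (mem_head _ _); rewrite ind_degree_setT; case: eqP => // ->.
- have /db : last v2 q \in [:: v1, v2 & q] by rewrite inE mem_last orbT.
  by rewrite ind_degree_setT; case: eqP => // ->.
Qed.

End Tree.

(** * Identifying bijections with permutations *)

Section Relabelling.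
Set Implicit Arguments.
Unset Strict Implicit.
Local Open Scope group_scope.
Variables (T U : finType).

Lemma bij_injective (s : bij T U) : injective (val s).
Proof. by case/andP: (valP s) => /injectiveP. Qed.

Lemma bij_surjective (s : bij T U) u : exists x, val s x = u.
Proof. by case/andP: (valP s) => _ /forallP/(_ u)/existsP[x /eqP]; exists x. Qed.

Lemma bij_perm_subproof (s : bij T U) (r : {perm T}) (f := [ffun x => val s (r x)]) :
  injectiveb f && [forall y, exists x, f x == y].
Proof.
apply/andP; split.
  by apply/injectiveP => x y; rewrite !ffunE => /bij_injective/perm_inj.
apply/forallP=> y; have [x <-] := bij_surjective s y.
by apply/existsP; exists (r^-1 x); rewrite ffunE permKV.
Qed.

(** The reference bijection [s] names persons by elements of [T], which makes every configuration a
    permutation of [T]. *)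
Definition bij_perm (s : bij T U) (r : {perm T}) : bij T U :=
  exist (fun f : {ffun T -> U} => injectiveb f && [forall y, exists x, f x == y])
    _ (bij_perm_subproof s r).

Lemma bij_permE s r x : val (bij_perm s r) x = val s (r x).
Proof. by rewrite ffunE. Qed.

Lemma bij_perm_onto s s' : exists r, s' = bij_perm s r.
Proof.
have ex x : exists y, val s y == val s' x.
  by have [y <-] := bij_surjective s (val s' x); exists y.
pose f x := xchoose (ex x).
have fE x : val s (f x) = val s' x by apply/eqP; apply: (xchooseP (ex x)).
have f_inj : injective f by move=> x y fxy; apply: (@bij_injective s'); rewrite -!fE fxy.
exists (perm f_inj); apply/val_inj/ffunP=> x.
by rewrite bij_permE permE fE.
Qed.

End Relabelling.

(** * Moves and class sizes in the complete multipartite graph *)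

Section Multipartite.
Set Implicit Arguments.
Unset Strict Implicit.

Lemma reach_FS (T : finType) (X : sgraph T) t (k : t.-tuple nat)
    (s0 : bij T (multipartite_vertex k)) s s' :
  reach X (fun p => tag (val s0 p)) setT s s' ->
  connect (adj (FS X (complete_multipartite k))) (bij_perm s0 s) (bij_perm s0 s').
Proof.
case/connectP=> r; elim: r s => [|s1 r IHr] s /=; first by move=> _ ->; exact: connect0.
case/andP=> /existsP[a /existsP[b] /and3P[/and3P[Xab _ _] cab /eqP def]].
move=> /IHr{}IHr /IHr; apply: connect_trans; apply: connect1.
apply/existsP; exists a; apply/existsP; exists b.
rewrite !bij_permE Xab def !permM tpermL tpermR !eqxx /= /multipartite_adj cab /=.
apply/forallP=> c; apply/implyP=> /andP[ca cb].
by rewrite !bij_permE permM tpermD // eq_sym.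
Qed.

Lemma card_multipartite_class t (k : t.-tuple nat) (c : 'I_t) :
  #|[set u : multipartite_vertex k | tag u == c]| <= tnth k c.
Proof.
rewrite -[X in _ <= X]card_ord -cardsT.
apply: (leq_trans _ (leq_imset_card (Tagged (fun i => 'I_(tnth k i))) _)).
apply/subset_leq_card/subsetP=> -[i j]; rewrite inE /= => /eqP ic.
by subst i; apply: imset_f.
Qed.

Lemma le_last_sorted t (k : t.-tuple nat) (i : 'I_t) :
  path leq 1 k -> 0 < tnth k i <= last 0 k.
Proof.
move=> pk; have t_gt0 : 0 < t := leq_ltn_trans (leq0n _) (ltn_ord i).
have /allP -> := order_path_min leq_trans pk; last exact: mem_tnth.
rewrite (tnth_nth 0) -nth_last.
apply: (sorted_leq_nth leq_trans leqnn); rewrite ?inE ?size_tuple ?ltn_predL //.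
  exact: path_sorted pk.
by rewrite -ltnS prednK.
Qed.

(** Without the last class, at least two nonempty classes remain. *)
Lemma gt1_sum_sub_last t (k : t.-tuple nat) :
  2 < t -> path leq 1 k -> 1 < \sum_(i < t) tnth k i - last 0 k.
Proof.
case: t k => // t k t2 pk.
have -> : last 0 k = tnth k ord_max by rewrite (tnth_nth 0) -nth_last size_tuple.
rewrite (bigD1 ord_max) //= addKn.
apply: (@leq_trans (\sum_(i < t.+1 | i != ord_max) 1)).
  by rewrite sum1_card cardC1 card_ord.
by apply: leq_sum => i _; case/andP: (le_last_sorted i pk).
Qed.

End Multipartite.

(** * Connectedness of the friends-and-strangers graph *)

Theorem theorem1p6 (t : nat) (k : t.-tuple nat) (n : nat)
    (T : finType) (X : sgraph T) :
  2 < t ->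
  path leq 1 k ->
  n = \sum_(i < t) tnth k i ->
  4 <= n ->
  #|T| = n ->
  is_tree X ->
  ~ has_bridge X (n - last 0 k) ->
  connected (FS X (complete_multipartite k)).
Proof.
move=> t2 pk def_n _ cardT tree nobr s0 s; have [conX acyc] := tree.
have conT := ind_connected_setT conX.
pose col p := tag (val s0 p).
have colP i : exists p, col p = i.
  have /andP[ki _] := le_last_sorted i pk.
  have [p def_p] := bij_surjective s0 (Tagged (fun i => 'I_(tnth k i)) (Ordinal ki)).
  by exists p; rewrite /col def_p.
have card_col c : #|[set p | col p == c]| <= last 0 k.
  have /andP[_] := le_last_sorted c pk; apply: leq_trans.
  apply: leq_trans (card_multipartite_class k c).
  rewrite -(card_imset _ (@bij_injective _ _ s0)).
  by apply/subset_leq_card/subsetP=> _ /imsetP[p pc ->]; rewrite !inE in pc *.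
have exch r p q : col p = col q -> exchangeable X col setT r p q.
  move=> cpq; have imT : r @: setT = setT.
    by apply/setP=> x; rewrite -(permKV r x) imset_f ?in_setT.
  apply: (same_color_exchangeable acyc conT erefl (c := col p)); rewrite ?imT ?in_setT //.
    (* Two further classes exist because [2 < t]. *)
    have /card_gt1P[i [j [ic jc ij]]] : 1 < #|predC1 (col p)|.
      by rewrite cardC1 card_ord ltn_predRL.
    have [x xi] := colP i; have [y yj] := colP j.
    exists x, y; split; rewrite ?in_setT // xi yj /= !inE ij negb_or.
    by rewrite !inE in ic jc; rewrite eq_sym ic eq_sym jc.
  (* The class of [p] may be smaller than the largest one, and [b] then longer than the excluded
     bridge; it is truncated. *)
  move=> b sb br; apply: nobr.
  have m1 : 1 < n - last 0 k by rewrite def_n; apply: gt1_sum_sub_last.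
  have sz : size (take (n - last 0 k) b) = n - last 0 k.
    apply: size_takel; rewrite sb cardsT cardT leq_sub2l //.
    apply: leq_trans (card_col (col p)); apply/subset_leq_card/subsetP=> u.
    by rewrite !inE => /andP[].
  exists (take (n - last 0 k) b) => //; apply: ind_bridge_setT => //.
    by rewrite sz.
  exact: ind_bridge_take.
have reach_edge a b : ind_adj X setT a b ->
    forall r, reach X col setT r (tperm a b * r)%g.
  move=> Sab r; have [cab|cab] := eqVneq (col (r a)) (col (r b)); last exact: swap_stepP.
  (* Swapping the positions [a] and [b] amounts to exchanging the persons [r a] and [r b]. *)
  by have := exch r _ _ cab; rewrite /exchangeable -tpermJ conjgE mulgA mulgV mul1g.
have reach_all (r : {perm T}) : reach X col setT 1%g r.
  pose P (u : {perm T}) := forall r', reach X col setT r' (u * r')%g.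
  suff /(_ 1%g) : P r by rewrite mulg1.
  have PM u v : P u -> P v -> P (u * v)%g.
    by move=> Pu Pv r'; rewrite -mulgA; apply: connect_trans (Pv r') (Pu _).
  have P1 : P 1%g by move=> r'; rewrite mul1g; apply: connect0.
  have [ts -> _] := prod_tpermP r; elim/big_ind: _ => // -[a b] _.
  exact: (tperm_connect P1 PM reach_edge (conT _ _ (in_setT _) (in_setT _))).
have -> : s0 = bij_perm s0 1%g by apply/val_inj/ffunP=> x; rewrite bij_permE perm1.
have [r ->] := bij_perm_onto s0 s.
exact: reach_FS.
Qed.
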